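(* There exist absolute constants $c_*>0$ and $K>0$ such that for every finite abelian group $\mathbf{G}$ of order $N$, the number $T(\mathbf{G})$ of ordered triples $(A,B,C)$ of subsets of $\mathbf{G}$ such that $x+y\neq z$ for all $x\in A$, $y\in B$, $z\in C$ satisfies $$|T(\mathbf{G})-3\cdot 4^N|\leqslant K(4-c_* )^N .$$
   Context: The subsets $A,B,C$ may be empty. *)

(* Defs.v *)
From HB Require Import structures.
From mathcomp Require Import all_boot all_order all_algebra.
From mathcomp Require Import reals.
Set Implicit Arguments. Unset Strict Implicit. Unset Printing Implicit Defensive.
Import Order.TTheory GRing.Theory Num.Theory.
Local Open Scope ring_scope.

Definition sumfree_triple (G : finZmodType) (A B C : {set G}) : bool :=
  [forall x in A, forall y in B, forall z in C, x + y != z].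

Definition T (G : finZmodType) : nat :=
  #|[set t : {set G} * {set G} * {set G} | sumfree_triple t.1.1 t.1.2 t.2]|.

(* Main.v *)
(* Replacing C by -C turns the condition into the symmetric one that x + y + z
   never vanishes on A x B x C.  Fix a large constant t and put d = 10 t.
   - Triples with an empty set number 3 * 4^N up to 3 * 2^N.
   - If C is nonempty, a point of C makes A and a translate of -B disjoint, so
     each C is in at most 3^N triples; there are O(1.02^N) sets C of size <= d.
   - If all three sets have at least d elements, choose F in C with |F| = d.  The
     graph joining x to y when -(x + y) is in F is d-regular bipartite, and a
     greedy choice of S in A with |S| <= N/t yields containers L of A and D of B,
     depending only on (F, S), with 9 (|L| + |D|) <= 10 N.  Doing so for the three
     pairs and averaging confines (A, B, C) to a box with at most 2^(5N/3)
     elements.  As 2^(5/3) < 3.2 and there are few choices of the (F, S), the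
     number of such triples is O(3.95^N). *)
Require Import Defs.
From HB Require Import structures.
From mathcomp Require Import all_boot all_order all_algebra.
From mathcomp Require Import reals.
From mathcomp Require Import zify ring lra.
Set Implicit Arguments. Unset Strict Implicit. Unset Printing Implicit Defensive.
Import Order.TTheory GRing.Theory Num.Theory.
Local Open Scope ring_scope.

(** * Counting sets of bounded size *)

Lemma sum_expr_card (R : comNzSemiRingType) (I : finType) (x : R) :
  \sum_(X : {set I}) x ^+ #|X| = (1 + x) ^+ #|I|.
Proof.
rewrite addrC -prodr_const bigA_distr; apply: eq_bigr => X _.
by rewrite -big_mkcond prodr_const.
Qed.

Definition small_sets (I : finType) (k : nat) := [set X : {set I} | (#|X| <= k)%N].

(** Each counted set has weight [x ^+ #|X|] at least [x ^+ k], and the weights of all sets add up to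
    [(1 + x) ^+ #|I|]. *)
Lemma card_small_sets_le (R : realFieldType) (I : finType) (k : nat) (x : R) :
  0 < x <= 1 -> #|small_sets I k|%:R * x ^+ k <= (1 + x) ^+ #|I|.
Proof.
case/andP=> x0 x1; rewrite -sum_expr_card -sum1_card natr_sum mulr_suml.
rewrite [leRHS](bigID (mem (small_sets I k))) /= -[leLHS]addr0 lerD //.
  apply: ler_sum => X; rewrite inE mul1r => leXk.
  by rewrite ler_wiXn2l ?(ltW x0).
by apply: sumr_ge0 => X _; rewrite exprn_ge0 ?(ltW x0).
Qed.

Lemma card_union_bound (U V : finType) (X : {set U}) (C : {set V})
    (box : V -> {set U}) (b : nat) :
    (forall u, u \in X -> exists2 v, v \in C & u \in box v) ->
    (forall v, v \in C -> #|box v| <= b)%N ->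
  (#|X| <= #|C| * b)%N.
Proof.
move=> XC boxb.
have sub : X \subset \bigcup_(v in C) box v.
  by apply/subsetP=> u /XC[v vC uv]; apply/bigcupP; exists v.
apply: leq_trans (subset_leq_card sub) _.
rewrite -sum_nat_const.
apply: (@leq_trans (\sum_(v in C) #|box v|)%N); last exact: leq_sum.
elim/big_rec2: _ => [|v m A _ le_mA]; first by rewrite cards0.
by apply: leq_trans (leq_card_setU _ _) _; rewrite leq_add2l.
Qed.

(** * The symmetric zero-sum form *)

Section ZeroSumFree.
Variable G : finZmodType.
Implicit Types A B C F S : {set G}.

Definition zerosumfree A B C := [forall x in A, forall y in B, - (x + y) \notin C].

Lemma zerosumfreeP A B C :
  reflect {in A & B, forall x y, - (x + y) \notin C} (zerosumfree A B C).
Proof.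
apply: (iffP forall_inP) => [h x y xA yB|h x xA]; first exact: (forall_inP (h x xA)).
by apply/forall_inP=> y; apply: h.
Qed.

Lemma zerosumfreeC A B C : zerosumfree A B C -> zerosumfree B A C.
Proof.
by move/zerosumfreeP=> h; apply/zerosumfreeP=> x y xB yA; rewrite addrC h.
Qed.

Lemma zerosumfree_rot A B C : zerosumfree A B C -> zerosumfree B C A.
Proof.
move/zerosumfreeP=> h; apply/zerosumfreeP=> y z yB zC.
by apply: contraL zC => xA; have := h _ _ xA yB; rewrite !opprD addrAC addNr add0r opprK.
Qed.

Lemma zerosumfreeS A B C A' B' C' :
  A' \subset A -> B' \subset B -> C' \subset C ->
  zerosumfree A B C -> zerosumfree A' B' C'.
Proof.
move=> /subsetP sA /subsetP sB /subsetP sC /zerosumfreeP h.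
apply/zerosumfreeP=> x y xA yB.
by apply: contra (h x y (sA _ xA) (sB _ yB)); apply: sC.
Qed.

Lemma sumfree_tripleN A B C :
  sumfree_triple A B C = zerosumfree A B (-%R @^-1: C).
Proof.
apply/forall_inP/zerosumfreeP => [h x y xA yB|h x xA].
  rewrite inE opprK; apply/negP=> xyC.
  by have /forall_inP/(_ y yB)/forall_inP/(_ _ xyC)/eqP := h x xA.
apply/forall_inP=> y yB; apply/forall_inP=> z zC; apply/eqP=> xyz.
by have := h x y xA yB; rewrite inE opprK xyz zC.
Qed.

Lemma T_zerosumfree :
  T G = #|[set t : {set G} * {set G} * {set G} | zerosumfree t.1.1 t.1.2 t.2]|.
Proof.
pose f (t : {set G} * {set G} * {set G}) := (t.1.1, t.1.2, -%R @^-1: t.2).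
have finv : involutive f.
  by case=> -[A B] C; rewrite /f /=; congr (_, _); apply/setP=> z; rewrite !inE opprK.
rewrite -(card_preimset _ (inv_inj finv)); apply: eq_card => t.
by rewrite !inE sumfree_tripleN.
Qed.

(** * Containers in the bipartite graph joining [x] to [y] when [- (x + y)] is in [F] *)

Definition right_container F S := [set y | zerosumfree S [set y] F].
(** These are the vertices that a greedy choice with threshold [t] would no longer add to [S]. *)
Definition left_container (t : nat) F S :=
  [set x | (#|[set y in right_container F S | - (x + y) \in F]| < t)%N].

Lemma card_translate F (x : G) : #|[set y | - (x + y) \in F]| = #|F|.
Proof.
rewrite -(card_preimset F (f := fun y => - (x + y))); last first.
  by move=> y z /oppr_inj/addrI.
by apply: eq_card => y; rewrite !inE.
Qed.

(* Double count the edges between the left container and the whole group: each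
   x has degree |F|, with fewer than t neighbours inside the right container. *)
Lemma card_containers (t : nat) F S :
  (#|F| * (#|left_container t F S| + #|right_container F S|)
    <= #|F| * #|G| + t * #|left_container t F S|)%N.
Proof.
set L := left_container t F S; set D := right_container F S.
have card_sum x (P : {set G}) :
    #|[set y in P | - (x + y) \in F]| = (\sum_(y in P) (- (x + y)%R \in F))%N.
  by rewrite -sum1dep_card big_mkcondr /=; apply: eq_bigr => y _; case: ifP.
have degL : (#|F| * #|L| =
    \sum_(x in L) (#|[set y in D | - (x + y)%R \in F]|
                   + #|[set y in ~: D | - (x + y)%R \in F]|))%N.
  rewrite mulnC -sum_nat_const; apply: eq_bigr => x _.
  rewrite -(card_translate F x) -(cardsID D [set y | - (x + y) \in F]).
  by congr (_ + _)%N; apply: eq_card => y; rewrite !inE // andbC.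
have degD : (\sum_(x in L) #|[set y in ~: D | - (x + y)%R \in F]| <= #|F| * #|~: D|)%N.
  under eq_bigr => x _ do rewrite card_sum.
  rewrite exchange_big /= mulnC -sum_nat_const; apply: leq_sum => y _.
  under eq_bigr => x _ do rewrite addrC.
  rewrite -card_sum -(card_translate F y); apply: subset_leq_card.
  by apply/subsetP=> x; rewrite !inE => /andP[].
have lowL : (\sum_(x in L) #|[set y in D | - (x + y)%R \in F]| <= t * #|L|)%N.
  rewrite mulnC -sum_nat_const; apply: leq_sum => x.
  by rewrite inE => /ltnW.
rewrite -(cardsC D) !mulnDr degL big_split /= addnC -addnA leq_add2l addnC.
exact: leq_add.
Qed.

Lemma container_exists (t : nat) F A B :
    (0 < t)%N -> zerosumfree A B F ->
  exists2 S : {set G}, (#|S| * t <= #|G|)%N &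
    A \subset left_container t F S /\ B \subset right_container F S.
Proof.
move=> t0 /zerosumfreeP ABF.
(* A maximal S covering at least t new vertices of the graph per element. *)
pose P S := (S \subset A) && (#|S| * t <= #|~: right_container F S|)%N.
have P0 : P set0 by rewrite /P sub0set cards0.
have [S /maxsetP[/andP[SA St] Smax] _] := maxset_exists P0.
exists S; first exact: leq_trans St (max_card _).
split; apply/subsetP=> u; rewrite inE; last first.
  move=> uB; apply/zerosumfreeP=> x y xS /set1P->.
  exact: ABF (subsetP SA _ xS) uB.
move=> uA; rewrite ltnNge; apply/negP=> le_t.
(* An element of [S] has no neighbour in the right container, which contradicts [le_t] as [t] is
   positive. *)
have [uS|uS] := boolP (u \in S).
  suff E : [set y in right_container F S | - (u + y) \in F] = set0.
    by rewrite E cards0 leqNgt t0 in le_t.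
  apply/setP=> y; rewrite !inE; apply/andP=> -[/zerosumfreeP h].
  by rewrite (negPf (h u y uS (set11 y))).
(* Otherwise the [t] new neighbours of [u] let [S] grow, against maximality. *)
have Pu : P (u |: S).
  rewrite /P subUset sub1set uA SA cardsU1 uS mulnDl mul1n addnC.
  apply: leq_trans (leq_add St le_t) _.
  set D := right_container F S; set D' := right_container F _.
  set E := [set y in D | _].
  have DE : [disjoint ~: D & E].
    by rewrite -setI_eq0; apply/eqP/setP=> y; rewrite !inE; case: zerosumfree.
  rewrite -cardsUI; move: DE; rewrite -setI_eq0 => /eqP->; rewrite cards0 addn0.
  apply: subset_leq_card; apply/subsetP=> y; rewrite !inE => /orP[|/andP[_ uyF]].
    by apply: contra; apply: zerosumfreeS; rewrite ?subsetUr.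
  by apply: contraL uyF => /zerosumfreeP; apply; rewrite !inE eqxx.
by have := Smax _ Pu (subsetUr _ _) => E; rewrite -E setU11 in uS.
Qed.

(** With [#|F|] equal to [10 * t], dividing the double count by [t] gives
    [9 |L| + 10 |D| <= 10 N]. *)
Lemma card_containers_ratio (t : nat) F S : (0 < t)%N -> #|F| = (10 * t)%N ->
  (9 * (#|left_container t F S| + #|right_container F S|) <= 10 * #|G|)%N.
Proof.
move=> t0 Ft; have := card_containers t F S; rewrite Ft.
set a := #|left_container _ _ _|; set b := #|right_container _ _| => le_ab.
by rewrite -(leq_pmul2l t0); lia.
Qed.

(** * Triples of three large sets *)

Definition fingerprints (t : nat) :=
  [set p : {set G} * {set G} | (#|p.1| == 10 * t)%N & (#|p.2| <= #|G| %/ t)%N].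

Lemma card_fingerprints (t : nat) :
  (#|fingerprints t| <= #|small_sets G (10 * t)| * #|small_sets G (#|G| %/ t)|)%N.
Proof.
rewrite -cardsX; apply: subset_leq_card; apply/subsetP=> p.
by rewrite !inE => /andP[/eqP-> ->]; rewrite leqnn.
Qed.

Lemma fingerprint_exists (t : nat) A B C :
    (0 < t)%N -> (10 * t <= #|C|)%N -> zerosumfree A B C ->
  exists2 p, p \in fingerprints t &
    A \subset left_container t p.1 p.2 /\ B \subset right_container p.1 p.2.
Proof.
move=> t0 tC ABC.
have [F Ft FC] : exists2 F : {set G}, #|F| = (10 * t)%N & F \subset C.
  exists [set x in take (10 * t) (enum C)].
    rewrite cardsE (card_uniqP _) ?take_uniq ?enum_uniq // size_takel //.
    by rewrite -cardE.
  by apply/subsetP=> x; rewrite inE => /mem_take; rewrite mem_enum.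
have [S St [AL BR]] :=
  container_exists t0 (zerosumfreeS (subxx A) (subxx B) FC ABC).
by exists (F, S); rewrite // !inE /= Ft eqxx leq_divRL.
Qed.

Lemma card_large_triples (t : nat) : (0 < t)%N ->
  (#|[set u : {set G} * {set G} * {set G} | zerosumfree u.1.1 u.1.2 u.2 &
       [&& 10 * t <= #|u.1.1|, 10 * t <= #|u.1.2| & 10 * t <= #|u.2|]]|
   <= #|fingerprints t| ^ 3 * 2 ^ (5 * #|G| %/ 3))%N.
Proof.
move=> t0.
pose L p := left_container t p.1 p.2; pose D p := right_container p.1 p.2.
pose W := fingerprints t.
(* The three fingerprints belong to the pairs [(A, B)], [(B, C)] and [(C, A)], so each set lies in
   one left and one right container. *)
pose box (v : _ * _ * _) :=
  setX (setX (powerset (L v.1.1 :&: D v.2)) (powerset (L v.1.2 :&: D v.1.1)))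
       (powerset (L v.2 :&: D v.1.2)).
have -> : (#|W| ^ 3 = #|setX (setX W W) W|)%N by rewrite !cardsX !expnS expn0 muln1 mulnA.
apply: (card_union_bound (box := box)) => [[[A B] C]|[[p q] r]].
  rewrite inE /= => /andP[ABC /and3P[tA tB tC]].
  have [p pW [pL pD]] := fingerprint_exists t0 tC ABC.
  have [q qW [qL qD]] := fingerprint_exists t0 tA (zerosumfree_rot ABC).
  have [r rW [rL rD]] := fingerprint_exists t0 tB (zerosumfree_rot (zerosumfree_rot ABC)).
  exists (p, q, r); first by rewrite !in_setX /= pW qW.
  by rewrite !in_setX /= !inE !subsetI pL pD qL qD rL rD.
rewrite !in_setX /= => /andP[/andP[pW qW] rW].
have ratio s : s \in fingerprints t -> (9 * (#|L s| + #|D s|) <= 10 * #|G|)%N.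
  by rewrite inE => /andP[/eqP s1 _]; apply: card_containers_ratio.
(* Twice [a + b + c] is at most the total size of the six containers, hence at most [10 n / 3]. *)
have avg n a b c lp lq lr dp dq dr : (a <= lp -> a <= dr -> b <= lq -> b <= dp ->
    c <= lr -> c <= dq -> 9 * (lp + dp) <= 10 * n -> 9 * (lq + dq) <= 10 * n ->
    9 * (lr + dr) <= 10 * n -> (a + b + c) * 3 <= 5 * n)%N by lia.
rewrite /box !cardsX !card_powerset -!expnD leq_exp2l // leq_divRL //=.
apply: (avg _ _ _ _ _ _ _ _ _ _ _ _ _ _ _ _ (ratio p pW) (ratio q qW) (ratio r rW));
  by rewrite subset_leq_card ?subsetIl ?subsetIr.
Qed.

(** * Triples with a small nonempty set *)

Lemma card_zerosumfree_pairs C : C != set0 ->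
  (#|[set p : {set G} * {set G} | zerosumfree p.1 p.2 C]| <= 3 ^ #|G|)%N.
Proof.
case/set0Pn=> z zC.
(* For fixed [A], the set [B] lies in the preimage of [~: A] under [x |-> - (z + x)]; the binomial
   identity at 2 sums these bounds. *)
have -> : (3 ^ #|G| = \sum_(A : {set G}) 2 ^ #|~: A|)%N.
  rewrite (reindex_inj (inv_inj (@setCK G))) /=.
  under eq_bigr => A _ do rewrite setCK.
  exact/esym/(sum_expr_card G (2 : nat)).
rewrite -sum1dep_card -(pair_big_dep xpredT (fun A B => zerosumfree A B C) (fun _ _ => 1%N)).
apply: leq_sum => A _; rewrite sum1dep_card.
have injf : injective (fun x : G => - (z + x)) by move=> x y /oppr_inj/addrI.
rewrite -(card_preimset (~: A) injf) -card_powerset; apply: subset_leq_card.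
apply/subsetP=> B; rewrite !inE => /zerosumfreeP ABC.
apply/subsetP=> y yB; rewrite !inE; apply: contraL zC => /ABC /(_ yB).
by rewrite opprD opprK addrK.
Qed.

Definition small_last (k : nat) := [set u : {set G} * {set G} * {set G} |
  [&& zerosumfree u.1.1 u.1.2 u.2, u.2 != set0 & #|u.2| <= k]%N].

Lemma card_small_last (k : nat) :
  (#|small_last k| <= #|small_sets G k| * 3 ^ #|G|)%N.
Proof.
(* The test on [C] empties the box of [set0], so one size bound serves every [C]. *)
pose box C := setX [set p | (C != set0) && zerosumfree p.1 p.2 C] [set C].
apply: (card_union_bound (box := box)) => [[p C]|C _].
  rewrite inE /= => /and3P[pC C0 Ck].
  by exists C; rewrite ?in_setX ?inE ?C0 ?pC /=.
rewrite cardsX cards1 muln1; have [->|C0] := eqVneq C set0.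
  by apply: leq_trans (leq0n _); rewrite leqn0 cards_eq0; apply/eqP/setP=> p; rewrite !inE.
exact: leq_trans (card_zerosumfree_pairs C0).
Qed.

Lemma card_nonempty_triples (t : nat) : (0 < t)%N ->
  (#|[set u : {set G} * {set G} * {set G} | zerosumfree u.1.1 u.1.2 u.2 &
       [&& u.1.1 != set0, u.1.2 != set0 & u.2 != set0]]|
   <= #|fingerprints t| ^ 3 * 2 ^ (5 * #|G| %/ 3)
      + 3 * (#|small_sets G (10 * t)| * 3 ^ #|G|))%N.
Proof.
move=> t0.
pose rot (u : {set G} * {set G} * {set G}) := (u.1.2, u.2, u.1.1).
have rotI : injective rot by move=> [[A B] C] [[A' B'] C'] [-> -> ->].
set Y := [set u | _ & _]; set X := small_last (10 * t).
have := card_large_triples t0; set Z := [set u | _ & _] => leZ.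
(* A triple of [Y] outside [Z] has a set of size below [10 * t], which at most two applications of
   [rot] put last. *)
have sub : Y \subset Z :|: (X :|: (rot @^-1: X :|: rot @^-1: (rot @^-1: X))).
  apply/subsetP=> -[[A B] C]; rewrite !inE /= => /andP[ABC /and3P[-> -> ->]].
  have BCA := zerosumfree_rot ABC; have CAB := zerosumfree_rot BCA.
  rewrite ABC BCA CAB /=.
  case: (leqP (10 * t) #|A|) => [_|/ltnW->]; last by rewrite !orbT.
  case: (leqP (10 * t) #|B|) => [_|/ltnW->]; last by rewrite !orbT.
  by case: (leqP (10 * t) #|C|) => [_|/ltnW->].
apply: leq_trans (subset_leq_card sub) _.
apply: leq_trans (leq_card_setU _ _) _; apply: leq_add => //.
have := card_small_last (10 * t); rewrite -/X; move: (_ * _)%N => M leX.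
rewrite !mulSn mul0n addn0.
apply: leq_trans (leq_card_setU _ _) _; apply: leq_add => //.
apply: leq_trans (leq_card_setU _ _) _.
by rewrite !(card_preimset _ rotI); apply: leq_add.
Qed.

(** * Triples with an empty set *)

Definition empty_triples := [set u : {set G} * {set G} * {set G} |
  [|| u.1.1 == set0, u.1.2 == set0 | u.2 == set0]].

Lemma card_empty_triples :
  (#|empty_triples| <= 3 * 4 ^ #|G| <= #|empty_triples| + 3 * 2 ^ #|G|)%N.
Proof.
pose O := [set set0 : {set G}]; pose U := [set: {set G}].
pose ZA := setX (setX O U) U; pose ZB := setX (setX U O) U; pose ZC := setX (setX U U) O.
have -> : empty_triples = ZA :|: ZB :|: ZC.
  by apply/setP=> u; rewrite !inE !andbT orbA.
have [cO cU] : #|O| = 1%N /\ #|U| = (2 ^ #|G|)%N.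
  by rewrite cards1 /U -powersetT card_powerset cardsT.
have four : (4 ^ #|G| = 2 ^ #|G| * 2 ^ #|G|)%N by rewrite -expnMn.
have cA : #|ZA| = (4 ^ #|G|)%N by rewrite !cardsX cO cU mul1n four.
have cB : #|ZB| = (4 ^ #|G|)%N by rewrite !cardsX cO cU muln1 four.
have cC : #|ZC| = (4 ^ #|G|)%N by rewrite !cardsX cO cU muln1 four.
(* Two empty sets leave one free set, so each pairwise overlap costs at most [2 ^ #|G|]. *)
have iAB : (#|ZA :&: ZB| <= 2 ^ #|G|)%N.
  rewrite -cU -(mul1n #|U|) -(mul1n 1%N) -cO -!cardsX; apply: subset_leq_card.
  by apply/subsetP=> u; rewrite !inE => /andP[/andP[/andP[-> _] _] /andP[/andP[_ ->] _]].
have iC : (#|(ZA :|: ZB) :&: ZC| <= 2 ^ #|G| + 2 ^ #|G|)%N.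
  rewrite setIUl; apply: leq_trans (leq_card_setU _ _) _; apply: leq_add.
    rewrite -cU -[leqRHS]mul1n -[leqRHS]muln1 -cO -!cardsX; apply: subset_leq_card.
    by apply/subsetP=> u; rewrite !inE => /andP[/andP[/andP[-> _] _] /andP[_ ->]].
  rewrite -cU -[leqRHS]muln1 -[#|U|]muln1 -cO -!cardsX; apply: subset_leq_card.
  by apply/subsetP=> u; rewrite !inE => /andP[/andP[/andP[_ ->] _] /andP[_ ->]].
have := cardsUI ZA ZB; have := cardsUI (ZA :|: ZB) ZC.
rewrite cA cB cC; move: iAB iC.
move: (#|_ :|: _|) (#|_ :&: _|) (#|_ :|: _|) (#|_ :&: _|).
lia.
Qed.

(** A triple with an empty set satisfies the condition vacuously. *)
Lemma T_split :
  T G = (#|empty_triples| + #|[set u : {set G} * {set G} * {set G} |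
    zerosumfree u.1.1 u.1.2 u.2 & [&& u.1.1 != set0, u.1.2 != set0 & u.2 != set0]]|)%N.
Proof.
rewrite T_zerosumfree -(cardsID empty_triples); congr (_ + _)%N; apply: eq_card => u;
  rewrite !inE; last by rewrite !negb_or andbC.
apply: andb_idl => /or3P[] /eqP->; apply/zerosumfreeP => x y; by rewrite !inE.
Qed.

End ZeroSumFree.

(** * Numerical estimates and conclusion *)

Lemma card_small_sets_ub (R : realFieldType) (I : finType) (k : nat) :
  #|small_sets I k|%:R <= 50 ^+ k * (51 / 50) ^+ #|I| :> R.
Proof.
have h : 0 < (50^-1 : R) <= 1 by apply/andP; split; lra.
have := card_small_sets_le I k h; rewrite exprVn ler_pdivrMr ?exprn_gt0 // mulrC.
by rewrite (_ : 1 + 50^-1 = 51 / 50) //; field.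
Qed.

(** Such a [t] makes [50 ^+ (N %/ t)] at most [(103 / 100) ^+ N], which keeps the choices of [S]
    few. *)
Lemma exists_expr_ge50 (R : realFieldType) :
  exists2 t, (0 < t)%N & 50 <= (103 / 100) ^+ t :> R.
Proof.
(* Bernoulli's inequality gives 1.03^100 >= 4, and 4^3 >= 50. *)
have bern n : 1 + (3 / 100) *+ n <= (103 / 100) ^+ n :> R.
  elim: n => [|n IHn]; first by rewrite mulr0n addr0.
  rewrite exprS mulrS; have : 0 <= (3 / 100) *+ n :> R by apply: mulrn_wge0; lra.
  by nra.
have r0 : 0 <= 103 / 100 :> R by lra.
have le4 : 4 <= (103 / 100) ^+ 100 :> R.
  by apply: le_trans (bern 100%N); rewrite -mulr_natr; lra.
exists (100 * 3)%N => //; rewrite exprM.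
apply: (@le_trans _ _ (4 ^+ 3)); first by lra.
by rewrite lerXn2r ?nnegrE ?exprn_ge0.
Qed.

(** Comparing cubes, [2 ^ 5 = 32] is below [(16 / 5) ^ 3 = 32.768]. *)
Lemma expr2_third_le (R : realFieldType) (n : nat) :
  2 ^+ (5 * n %/ 3) <= (16 / 5) ^+ n :> R.
Proof.
rewrite -(@ler_pXn2r _ 3) ?nnegrE ?exprn_ge0 //; last by lra.
apply: (@le_trans _ _ (2 ^+ (5 * n))).
  by rewrite -exprM ler_eXn2l ?ltr1n // leq_trunc_div.
rewrite exprAC exprM lerXn2r ?nnegrE ?exprn_ge0 //; lra.
Qed.

Theorem theorem6 (R : realType) :
  exists (c K : R), 0 < c /\ 0 < K /\
    forall G : finZmodType,
      `| (T G)%:R - 3 * 4 ^+ #|G| | <= K * (4 - c) ^+ #|G|.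
Proof.
have [t t0 t50] := exists_expr_ge50 R.
pose q : R := 50 ^+ (10 * t).
have q0 : 0 < q by rewrite exprn_gt0.
(* In [K], [q ^+ 3] pays for the large triples, [3 * q] for those with a small set, and [3] for
   overlaps among the empty ones. *)
exists (1 / 20), (q ^+ 3 + 3 * q + 3); split; first by lra.
split; first by rewrite !addr_gt0 ?mulr_gt0 ?exprn_gt0.
move=> G; set N := #|G|; set rho : R := 4 - 1 / 20.
have leN (x y : R) : 0 <= x <= y -> x ^+ N <= y ^+ N.
  by case/andP=> x0 xy; rewrite lerXn2r ?nnegrE // (le_trans x0).
have two_le : 2 ^+ N <= rho ^+ N by apply: leN; rewrite /rho; apply/andP; split; lra.
have small_le : #|small_sets G (10 * t)|%:R * 3 ^+ N <= q * rho ^+ N.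
  apply: le_trans (ler_wpM2r _ (card_small_sets_ub R G _)) _; first exact: exprn_ge0.
  rewrite -mulrA ler_pM2l // -exprMn.
  by apply: leN; rewrite /rho; apply/andP; split; lra.
have tiny_le : #|small_sets G (N %/ t)|%:R <= ((103 / 100) * (51 / 50)) ^+ N :> R.
  apply: le_trans (card_small_sets_ub R G _) _.
  rewrite [leRHS]exprMn ler_pM2r ?exprn_gt0 //; last by lra.
  apply: (@le_trans _ _ (((103 / 100) ^+ t) ^+ (N %/ t))).
    by rewrite lerXn2r ?nnegrE ?exprn_ge0 //; lra.
  by rewrite -exprM ler_eXn2l; [rewrite mulnC leq_trunc_div | lra].
(* Growth rate of the fingerprints: 1.02 from [F], and 1.03 times 1.02 from [S]. *)
pose s : R := (51 / 50) * ((103 / 100) * (51 / 50)).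
have s0 : 0 <= s by rewrite /s; lra.
have fp_le : #|fingerprints G t|%:R <= q * s ^+ N :> R.
  apply: (@le_trans _ _ (#|small_sets G (10 * t)| * #|small_sets G (N %/ t)|)%:R).
    by rewrite ler_nat card_fingerprints.
  rewrite natrM (exprMn N (51 / 50)) [leRHS]mulrA.
  apply: ler_pM => //; exact: card_small_sets_ub.
have large_le :
    #|fingerprints G t|%:R ^+ 3 * 2 ^+ (5 * N %/ 3) <= q ^+ 3 * rho ^+ N.
  apply: (@le_trans _ _ ((q * s ^+ N) ^+ 3 * (16 / 5) ^+ N)).
    apply: ler_pM; rewrite ?exprn_ge0 ?expr2_third_le //.
    by rewrite lerXn2r ?nnegrE // mulr_ge0 ?exprn_ge0 ?(ltW q0).
  rewrite [(q * _) ^+ 3]exprMn -mulrA ler_pM2l ?exprn_gt0 // exprAC -exprMn.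
  (* The tightest estimate: [s ^+ 3 * (16 / 5)] is about 3.938, just below [rho], which is 3.95. *)
  by apply: leN; rewrite /rho /s; apply/andP; split; lra.
have /andP[] := card_empty_triples G; have := card_nonempty_triples G t0.
rewrite T_split -/N; move: #|empty_triples G| #|[set u | _ & _]| => e w le_w le_e ge_e.
have {}le_w : w%:R <= q ^+ 3 * rho ^+ N + 3 * (q * rho ^+ N).
  move: le_w; rewrite -(ler_nat R) => /le_trans; apply.
  rewrite natrD lerD //; first by rewrite natrM !natrX.
  by rewrite natrM ler_pM2l ?ltr0n // natrM natrX.
have {}le_e : e%:R <= 3 * 4 ^+ N :> R by rewrite -natrX -natrM ler_nat.
have {}ge_e : 3 * 4 ^+ N <= e%:R + 3 * 2 ^+ N :> R.
  by rewrite -!natrX -!natrM -natrD ler_nat.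
have qrho0 : 0 <= q ^+ 3 * rho ^+ N + 3 * (q * rho ^+ N) by apply: le_trans le_w.
have -> : (q ^+ 3 + 3 * q + 3) * rho ^+ N =
  (q ^+ 3 * rho ^+ N + 3 * (q * rho ^+ N)) + 3 * rho ^+ N by ring.
have w0 : 0 <= w%:R :> R by [].
(* The excess over [3 * 4 ^+ N] is at most [w], the deficit at most [3 * 2 ^+ N]. *)
by rewrite natrD ler_norml; apply/andP; split; lra.
Qed.
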